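(* Let $D$ be an integral domain and $\star$ a semistar operation on $D$. The following are equivalent: (1) $D$ is a $\star$-Dedekind domain ($\star$-DD). (2) Each nonzero quasi-$\tilde\star$-prime ideal of $D$ is quasi-$\tilde\star$-invertible.
   Context: Let $D$ be an integral domain with quotient field $K$. $\overline{\boldsymbol F}(D)$ denotes the set of all nonzero $D$-submodules of $K$, and $\boldsymbol f(D)$ the set of nonzero finitely generated $D$-submodules of $K$. For $E,F\in\overline{\boldsymbol F}(D)$, $(E:F)=\{z\in K: zF\subseteq E\}$. A semistar operation on $D$ is a map $\star:\overline{\boldsymbol F}(D)\to\overline{\boldsymbol F}(D)$, $E\mapsto E^\star$, such that for all $0\neq x\in K$ and $E,F\in\overline{\boldsymbol F}(D)$: $(xE)^\star=xE^\star$; $E\subseteq F$ implies $E^\star\subseteq F^\star$; $E\subseteq E^\star$ and $(E^\star)^\star=E^\star$. The semistar operation $\star_f$ is defined by $E^{\star_f}:=\bigcup\{F^\star : F\in\boldsymbol f(D),\ F\subseteq E\}$. A quasi-$\star$-ideal of $D$ is a nonzero ideal $I$ of $D$ with $I=I^\star\cap D$; a quasi-$\star$-prime is a nonzero prime ideal that is a quasi-$\star$-ideal (and similarly for other semistar operations such as $\tilde\star$). $\mathcal{M}(\star_f)$ is the set of quasi-$\star_f$-maximal ideals, i.e. the maximal elements of the set of proper quasi-$\star_f$-ideals (these are prime). The semistar operation $\tilde\star$ is defined by $E^{\tilde\star}:=\bigcap\{ED_Q : Q\in\mathcal{M}(\star_f)\}$ (the empty intersection being $K$). $D$ is $\star$-Noetherian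 if it has the ascending chain condition on quasi-$\star$-ideals. A nonzero ideal $I$ is $\star$-invertible if $(I(D:I))^\star=D^\star$. $D$ is a P$\star$MD if each nonzero finitely generated ideal of $D$ is $\star_f$-invertible. $D$ is a $\star$-Dedekind domain ($\star$-DD) if it is $\star$-Noetherian and a P$\star$MD. $E\in\overline{\boldsymbol F}(D)$ is quasi-$\tilde\star$-invertible if $(E(D^{\tilde\star}:E))^{\tilde\star}=D^{\tilde\star}$. *)

(* Defs.v *)
From HB Require Import structures.
From mathcomp Require Import all_boot all_order all_algebra.
From mathcomp Require Import boolp classical_sets.

Set Implicit Arguments.
Unset Strict Implicit.
Unset Printing Implicit Defensive.

Import GRing.Theory.

Local Open Scope classical_set_scope.
Local Open Scope ring_scope.

Section Submodules.
Variable D : idomainType.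
Local Notation K := {fraction D}.
Local Notation "x %:K" := (tofrac x : K) (at level 2, left associativity).

Definition D_submodule (E : set K) : Prop :=
  E 0 /\ forall (a : D) (x y : K), E x -> E y -> E (a%:K * x + y).

Definition Fbar (E : set K) : Prop :=
  D_submodule E /\ exists2 x : K, E x & x != 0.

Definition span n (g : 'I_n -> K) : set K :=
  [set x | exists c : 'I_n -> D, x = \sum_(i < n) (c i)%:K * g i].

Definition fg (E : set K) : Prop :=
  Fbar E /\ exists (n : nat) (g : 'I_n -> K), E = span g.

Definition scale (x : K) (E : set K) : set K := [set x * y | y in E].

Definition colon (E F : set K) : set K :=
  [set z | scale z F `<=` E].

Definition mulmod (E F : set K) : set K :=
  [set x | exists (n : nat) (e f : 'I_n -> K),
    (forall i, E (e i) /\ F (f i)) /\ x = \sum_(i < n) e i * f i].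

(* The copy inside K of a subset of D. *)
Definition inK (I : set D) : set K := [set a%:K | a in I].

Definition DinK : set K := inK setT.

(* Ideals need not be proper. *)
Definition is_ideal (I : set D) : Prop :=
  I 0 /\ forall a x y : D, I x -> I y -> I (a * x + y).

Definition nonzero_ideal (I : set D) : Prop :=
  is_ideal I /\ exists2 a : D, I a & a != 0.

Definition prime_ideal (P : set D) : Prop :=
  [/\ is_ideal P, P <> setT & forall a b : D, P (a * b) -> P a \/ P b].

(* The ring D_Q; it is only used when Q is a prime ideal. *)
Definition localization (Q : set D) : set K :=
  [set x | exists a s : D, ~ Q s /\ x = a%:K / s%:K].

End Submodules.

Arguments DinK D : clear implicits.

Section Semistar.
Variable D : idomainType.
Local Notation K := {fraction D}.

(* Semistar operations are represented by total maps on subsets of K, of which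
   only the values on Fbar are constrained or used. *)
Definition semistar (star : set K -> set K) : Prop :=
  [/\ forall E, Fbar E -> Fbar (star E),
      forall (x : K) E, x != 0 -> Fbar E ->
        star (scale x E) = scale x (star E),
      forall E F, Fbar E -> Fbar F -> E `<=` F -> star E `<=` star F,
      forall E, Fbar E -> E `<=` star E
    & forall E, Fbar E -> star (star E) = star E].

Definition star_f (star : set K -> set K) (E : set K) : set K :=
  \bigcup_(F in [set F | fg F /\ F `<=` E]) star F.

Definition quasi_ideal (star : set K -> set K) (I : set D) : Prop :=
  nonzero_ideal I /\ I = [set a : D | star (inK I) (tofrac a)].

Definition quasi_prime (star : set K -> set K) (P : set D) : Prop :=
  prime_ideal P /\ quasi_ideal star P.

Definition quasi_maximal (star : set K -> set K) (M : set D) : Prop :=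
  [/\ quasi_ideal star M, M <> setT
    & forall J, quasi_ideal star J -> J <> setT -> M `<=` J -> J = M].

(* An empty intersection is setT, i.e. K. *)
Definition star_tilde (star : set K -> set K) (E : set K) : set K :=
  \bigcap_(Q in quasi_maximal (star_f star)) mulmod E (localization Q).

Definition star_noetherian (star : set K -> set K) : Prop :=
  forall I : nat -> set D,
    (forall n, quasi_ideal star (I n)) -> (forall n, I n `<=` I n.+1) ->
    exists n, forall m, (n <= m)%N -> I m = I n.

Definition star_invertible (star : set K -> set K) (I : set D) : Prop :=
  star (mulmod (inK I) (colon (DinK D) (inK I))) = star (DinK D).

Definition PstarMD (star : set K -> set K) : Prop :=
  forall I : set D, nonzero_ideal I -> fg (inK I) ->
    star_invertible (star_f star) I.

Definition star_dedekind (star : set K -> set K) : Prop :=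
  star_noetherian star /\ PstarMD star.

Definition quasi_invertible (star : set K -> set K) (E : set K) : Prop :=
  star (mulmod E (colon (star (DinK D)) E)) = star (DinK D).

End Semistar.

(* Main.v *)
(* Write cl for the trace of star_f on ideals of D, til for that of
   star_tilde, and M for the set of quasi-star_f-maximal ideals; a nonzero
   ideal A has 1 in cl A iff A lies in no Q in M.

   (1) => (2): by the chain condition P is contained in the star-closure of a
   finitely generated s in P.  For p in P both s and (p, s) are invertible
   modulo every Q in M, which forces p in s D_Q; hence (D : s) is contained in
   (D^tilde : P), and P inherits invertibility from s.

   (2) => (1): if P is quasi-star_tilde-invertible then P is finitely generated
   up to til, and P D_Q is principal for every Q in M.  By a Cohen-type
   argument all til-closed ideals are finitely generated up to til, whence the
   chain condition.  If r generates Q D_Q, the intersection N of the r^n D_Q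
   satisfies N = r N and its trace on D is zero or an invertible prime, so
   N = 0 and D_Q is a valuation ring; thus I (D : I) lies in no Q in M for
   finitely generated I. *)

Require Import Defs.
From mathcomp Require Import all_boot all_order all_algebra.
From mathcomp Require Import boolp classical_sets.
From mathcomp Require Import ring.

Set Implicit Arguments.
Unset Strict Implicit.
Unset Printing Implicit Defensive.

Import GRing.Theory.

(** * Zorn's lemma above a given set *)

Section ZornAbove.
Local Open Scope classical_set_scope.

(** Conditions with finitely many witnesses therefore pass from the union of a chain to one member;
    all later arguments on chains rest on this. *)
Lemma seq_in_chain (T : eqType) (C : set (set T)) (s : seq T) :
  C !=set0 -> total_on C subset ->
  (forall x, x \in s -> (\bigcup_(X in C) X) x) ->
  exists2 X, C X & forall x, x \in s -> X x.
Proof.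
move=> [X0 CX0] totC; elim: s => [|a s IH] sC; first by exists X0.
have [|X CX sX] := IH; first by move=> x xs; apply: sC; rewrite inE xs orbT.
have [Y CY Ya] := sC a (mem_head _ _).
have [XY|YX] := totC X Y CX CY.
  by exists Y => // x /[!inE] /orP[/eqP-> //|/sX/XY].
by exists X => // x /[!inE] /orP[/eqP->|/sX //]; exact: YX.
Qed.

(** Zorn is applied to the sets whose union with [A] satisfies [P]: the empty chain is then settled
    by [P A], and only nonempty chains remain for [chainP]. *)
Lemma maximal_above (T : Type) (P : set (set T)) (A : set T) : P A ->
  (forall C : set (set T), C !=set0 -> C `<=` P -> total_on C subset ->
     P (\bigcup_(X in C) X)) ->
  exists M, [/\ P M, A `<=` M & forall B, P B -> M `<=` B -> B = M].
Proof.
move=> PA chainP.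
have [|B [PB maxB]] := @Zorn_bigcup T [set X | P (A `|` X)].
  move=> C CP totC /=; have [->|/set0P [X0 CX0]] := eqVneq C set0.
    by rewrite bigcup_set0 setU0.
  have -> : A `|` \bigcup_(X in C) X = \bigcup_(Y in [set A `|` X | X in C]) Y.
    apply/seteqP; split=> x.
      case=> [Ax|[X CX Xx]]; first by exists (A `|` X0); [exists X0|left].
      by exists (A `|` X); [exists X|right].
    by case=> _ [X CX <-] [Ax|Xx]; [left|right; exists X].
  apply: chainP; first by exists (A `|` X0), X0.
    by move=> _ [X CX <-]; exact: CP.
  move=> _ _ [X CX <-] [Y CY <-].
  by case: (totC X Y CX CY) => ?; [left|right]; apply: setUS.
exists (A `|` B); split=> // E PE ABE.
apply/seteqP; split=> // x Ex; right; apply: contrapT => nBx.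
apply: (maxB E) => /=.
  by split=> [y By|EB]; [apply: ABE; right|exact/nBx/EB].
by rewrite setUidr // => y Ay; apply: ABE; left.
Qed.

End ZornAbove.

(** * Ideals and submodules *)

Section Ideals.
Local Open Scope classical_set_scope.
Local Open Scope ring_scope.
Variable D : idomainType.
Local Notation K := {fraction D}.
Local Notation "x %:K" := (tofrac x : K) (at level 2, left associativity).
Implicit Types (I J P Q : set D) (s t : seq D) (E F : set K).

Lemma idealD I x y : is_ideal I -> I x -> I y -> I (x + y).
Proof. by move=> [_ HI] Ix Iy; rewrite -[x]mul1r; exact: HI. Qed.

Lemma idealM I a x : is_ideal I -> I x -> I (a * x).
Proof. by move=> [I0 HI] Ix; rewrite -[_ * _]addr0; exact: HI. Qed.

Lemma submodD E x y : D_submodule E -> E x -> E y -> E (x + y).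
Proof.
by move=> [_ HE] Ex Ey; rewrite -[x]mul1r -(rmorph1 (@tofrac D)); exact: HE.
Qed.

Lemma submodM E a x : D_submodule E -> E x -> E (a%:K * x).
Proof. by move=> [E0 HE] Ex; rewrite -[_ * _]addr0; exact: HE. Qed.

Lemma submod_sum E (n : nat) (g : 'I_n -> K) :
  D_submodule E -> (forall i, E (g i)) -> E (\sum_i g i).
Proof.
move=> subE Eg; apply: big_ind => //; first by case: subE.
by move=> x y; exact: submodD.
Qed.

Lemma inKE I a : inK I a%:K <-> I a.
Proof. by split=> [[b Ib /eqP]|Ia]; [rewrite tofrac_eq => /eqP <-|exists a]. Qed.

Lemma DinKE x : DinK D x <-> exists d, x = d%:K.
Proof. by split=> [[d _ <-]|[d ->]]; exists d. Qed.

Lemma inK_inj I J : inK I = inK J -> I = J.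
Proof.
move=> IJ; apply/seteqP; split=> a Ia; apply/inKE.
  by rewrite -IJ; exact/inKE.
by rewrite IJ; exact/inKE.
Qed.

Lemma inKS I J : I `<=` J -> inK I `<=` inK J.
Proof. by move=> IJ _ [a Ia <-]; exists a => //; exact: IJ. Qed.

Lemma inK_submod I : is_ideal I -> D_submodule (inK I).
Proof.
move=> idI; split; first by exists 0; [case: idI|rewrite rmorph0].
move=> a _ _ [x Ix <-] [y Iy <-]; exists (a * x + y); last by ring.
by case: idI => _; apply.
Qed.

Lemma inK_Fbar I : nonzero_ideal I -> Fbar (inK I).
Proof.
move=> [idI [a Ia a0]]; split; first exact: inK_submod.
by exists a%:K; [exists a|rewrite tofrac_eq0].
Qed.

Lemma nonzero_idealT : nonzero_ideal [set: D].
Proof. by split=> //; exists 1 => //; exact: oner_neq0. Qed.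

Lemma nonzero_idealS I J : is_ideal J -> nonzero_ideal I -> I `<=` J ->
  nonzero_ideal J.
Proof. by move=> idJ [_ [a Ia a0]] IJ; split=> //; exists a => //; exact: IJ. Qed.

Lemma bigcup_ideal (C : set (set D)) : C !=set0 -> total_on C subset ->
  (forall I, C I -> is_ideal I) -> is_ideal (\bigcup_(I in C) I).
Proof.
move=> C0 totC idC; split.
  by have [I CI] := C0; exists I => //; case: (idC I CI).
move=> a x y Ux Uy.
have [|I CI sI] := @seq_in_chain _ C [:: x; y] C0 totC.
  by move=> z; rewrite !inE => /orP[/eqP->|/eqP->].
exists I => //; case: (idC I CI) => _; apply; apply: sI; rewrite !inE eqxx //.
by rewrite orbT.
Qed.

(** * Finitely generated ideals *)

Local Notation span := Defs.span.

(** As an intersection of ideals, so that inclusions are tested on generators; [inK_gen] recovers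
    the linear combinations. *)
Definition gen s : set D :=
  [set x | forall J, is_ideal J -> (forall y, y \in s -> J y) -> J x].

Lemma gen_ideal s : is_ideal (gen s).
Proof.
split=> [J [J0 _] _|a x y sx sy J idJ sJ]; first exact: J0.
by case: (idJ) => _; apply; [exact: sx|exact: sy].
Qed.

Lemma mem_gen s x : x \in s -> gen s x.
Proof. by move=> xs J _; apply. Qed.

Lemma gen_sub s J : is_ideal J -> (forall y, y \in s -> J y) -> gen s `<=` J.
Proof. by move=> idJ sJ x; apply. Qed.

Lemma gen_subseq s t : {subset s <= t} -> gen s `<=` gen t.
Proof.
by move=> st; apply: gen_sub => [|y /st]; [exact: gen_ideal|exact: mem_gen].
Qed.

Lemma gen_nonzero s : (exists2 d, d \in s & d != 0) <-> nonzero_ideal (gen s).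
Proof.
split=> [[d ds d0]|[_ [a sa a0]]].
  by split; [exact: gen_ideal|exists d => //; exact: mem_gen].
apply: contrapT => ns; move/eqP: a0; apply; apply: (sa [set 0]).
  by split=> // b _ _ -> ->; rewrite mulr0 addr0.
by move=> y ys; apply: contrapT => /eqP y0; apply: ns; exists y.
Qed.

Lemma span_submod n (g : 'I_n -> K) : D_submodule (span g).
Proof.
split; first by exists (fun=> 0); rewrite big1 // => i _; rewrite rmorph0 mul0r.
move=> a _ _ [c ->] [d ->]; exists (fun i => a * c i + d i).
rewrite mulr_sumr -big_split; apply: eq_bigr => i _ /=; ring.
Qed.

Lemma span_gen n (g : 'I_n -> K) i : span g (g i).
Proof.
exists (fun j => (j == i)%:R); rewrite (bigD1 i) //= eqxx rmorph1 mul1r big1 ?addr0 //.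
by move=> j /negPf ->; rewrite rmorph0 mul0r.
Qed.

Lemma span_sub n (g : 'I_n -> K) E :
  D_submodule E -> (forall i, E (g i)) -> span g `<=` E.
Proof.
by move=> subE Eg _ [c ->]; apply: submod_sum => // i; exact: submodM.
Qed.

Lemma inK_gen s : inK (gen s) = span (fun i : 'I_(size s) => (s`_i)%:K).
Proof.
apply/seteqP; split.
  have : gen s `<=` [set x | span (fun i : 'I_(size s) => (s`_i)%:K) x%:K].
    apply: gen_sub => [|y ys /=].
      have [s0 sL] := span_submod (fun i : 'I_(size s) => (s`_i)%:K).
      split=> [|a x y sx sy] /=; first by rewrite rmorph0.
      by rewrite rmorphD rmorphM; exact: sL.
    have lt_ys : (index y s < size s)%N by rewrite index_mem.
    have := span_gen (fun i : 'I_(size s) => (s`_i)%:K) (Ordinal lt_ys).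
    by rewrite /= nth_index.
  by move=> sub _ [a sa <-]; exact: sub.
apply: span_sub => [|i]; first exact/inK_submod/gen_ideal.
by exists s`_i => //; apply: mem_gen; apply: mem_nth.
Qed.

Lemma gen_fg s : nonzero_ideal (gen s) -> fg (inK (gen s)).
Proof.
by move=> nzs; split; [exact: inK_Fbar|rewrite inK_gen; exists (size s), (fun i => (s`_i)%:K)].
Qed.

(** Lifting the generators to [D] lets finite lists in [D] replace finitely generated submodules of
    [K] from here on. *)
Lemma fg_gen F J : fg F -> F `<=` inK J ->
  exists s, [/\ forall d, d \in s -> J d, nonzero_ideal (gen s) & F = inK (gen s)].
Proof.
move=> [[subF [x Fx x0]] [n [g eF]]] FJ.
have gJ i : exists2 a, J a & a%:K = g i by apply: FJ; rewrite eF; exact: span_gen.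
pose d i := projT1 (cid2 (gJ i)).
have dP i : J (d i) /\ (d i)%:K = g i by rewrite /d; case: cid2.
have eFs : F = inK (gen (codom d)).
  rewrite eF; apply/seteqP; split.
    apply: span_sub => [|i]; first exact/inK_submod/gen_ideal.
    by rewrite -(dP i).2; exists (d i) => //; apply: mem_gen; exact: codom_f.
  rewrite inK_gen; apply: span_sub => [|i]; first exact: span_submod.
  have /codomP[j ->] : (codom d)`_i \in codom d by apply: mem_nth.
  by case: (dP j) => _ ->; exact: span_gen.
exists (codom d); split=> //; first by move=> _ /codomP[i ->]; case: (dP i).
split; first exact: gen_ideal.
move: Fx; rewrite eFs => -[a sa ax]; exists a => //.
by rewrite -tofrac_eq0 ax.
Qed.

(** * Products, colons and saturations *)

Lemma mulmodP E F x : mulmod E F x <-> exists l : seq (K * K),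
  (forall p, p \in l -> E p.1 /\ F p.2) /\ x = \sum_(p <- l) p.1 * p.2.
Proof.
split=> [[n [e [f [ef ->]]]]|[l [lEF ->]]].
  exists [seq (e i, f i) | i <- enum 'I_n]; split; last by rewrite big_map big_enum.
  by move=> _ /mapP[i _ ->]; exact: ef.
exists (size l), (fun i => (tnth (in_tuple l) i).1), (fun i => (tnth (in_tuple l) i).2).
split; last by rewrite big_tnth.
by move=> i; apply/lEF/mem_tnth.
Qed.

Lemma mem_mulmod E F x y : E x -> F y -> mulmod E F (x * y).
Proof.
move=> Ex Fy; apply/mulmodP; exists [:: (x, y)]; rewrite big_seq1; split=> //.
by move=> p; rewrite inE => /eqP ->.
Qed.

Lemma mulmod_submod E F : D_submodule E -> D_submodule (mulmod E F).
Proof.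
move=> subE; split.
  by apply/mulmodP; exists [::]; rewrite big_nil.
move=> a x y /mulmodP[l [lEF ->]] /mulmodP[m [mEF ->]]; apply/mulmodP.
exists ([seq (a%:K * p.1, p.2) | p <- l] ++ m); split.
  move=> p; rewrite mem_cat => /orP[/mapP[q /lEF[Eq Fq] ->]|/mEF //].
  by split=> //; exact: submodM.
rewrite big_cat big_map mulr_sumr /=; congr (_ + _).
by apply: eq_bigr => p _; rewrite mulrA.
Qed.

Lemma mulmod_sub E F G : D_submodule G ->
  (forall x y, E x -> F y -> G (x * y)) -> mulmod E F `<=` G.
Proof.
move=> subG EFG _ [n [e [f [ef ->]]]]; apply: submod_sum => // i.
by case: (ef i) => ? ?; exact: EFG.
Qed.

Lemma submod_preimage E : D_submodule E -> is_ideal [set a : D | E a%:K].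
Proof.
move=> [E0 EL]; split=> [|a x y Ex Ey] /=; first by rewrite rmorph0.
by rewrite rmorphD rmorphM; exact: EL.
Qed.

Lemma submod_scaled_preimage E u : D_submodule E -> is_ideal [set a : D | E (u * a%:K)].
Proof.
move=> [E0 EL]; split=> [|a x y Ex Ey] /=; first by rewrite rmorph0 mulr0.
have -> : u * (a * x + y)%:K = a%:K * (u * x%:K) + u * y%:K by ring.
exact: EL.
Qed.

Lemma colonP E I u : colon E (inK I) u <-> forall i, I i -> E (u * i%:K).
Proof.
split=> [uIE i Ii|uIE _ [_ [i Ii <-] <-]]; last exact: uIE.
by apply: uIE; exists i%:K; [exists i|].
Qed.

Lemma DinK_submod : D_submodule (DinK D).
Proof. by apply: inK_submod. Qed.

(* [saturation Q E] is [E D_Q] when [Q] is prime, see [mulmod_localization]. *)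
Definition saturation Q E : set K := [set x | exists2 w : D, ~ Q w & E (w%:K * x)].

Lemma primeM P a b : prime_ideal P -> ~ P a -> ~ P b -> ~ P (a * b).
Proof. by move=> [_ _ primeP] Pa Pb /primeP[]. Qed.

Lemma prime1 P : is_ideal P -> P <> setT -> ~ P 1.
Proof.
move=> idP neqT P1; apply: neqT; apply/seteqP; split=> // x _.
by rewrite -[x]mulr1; exact: idealM.
Qed.

Lemma prime_not1 P : prime_ideal P -> ~ P 1.
Proof. by move=> [idP neqT _]; exact: prime1. Qed.

Lemma saturation_id Q E : prime_ideal Q -> E `<=` saturation Q E.
Proof. by move=> pQ x Ex; exists 1; [exact: prime_not1|rewrite rmorph1 mul1r]. Qed.

Lemma saturation_submod Q E : prime_ideal Q -> D_submodule E ->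
  D_submodule (saturation Q E).
Proof.
move=> pQ subE; split; first by apply: saturation_id => //; case: subE.
move=> a x y [v Qv Ex] [w Qw Ey]; exists (v * w); first exact: primeM.
have -> : (v * w)%:K * (a%:K * x + y)
  = (a * w)%:K * (v%:K * x) + v%:K * (w%:K * y) by ring.
by apply: submodD => //; exact: submodM.
Qed.

Lemma mulmod_localization Q E : prime_ideal Q -> D_submodule E ->
  mulmod E (localization Q) = saturation Q E.
Proof.
move=> pQ subE.
have nz (s : D) : ~ Q s -> s%:K != 0.
  move=> Qs; rewrite tofrac_eq0; apply/eqP => s0; apply: Qs; rewrite s0.
  by case: pQ => -[].
apply/seteqP; split.
  apply: mulmod_sub => [|x _ Ex [a [s [Qs ->]]]]; first exact: saturation_submod.
  exists s => //.
  have -> : s%:K * (x * (a%:K / s%:K)) = a%:K * x.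
    by rewrite mulrCA [s%:K * _]mulrC divfK ?nz // mulrC.
  exact: submodM.
move=> x [w Qw Ex]; have -> : x = (w%:K * x) * (1%:K / w%:K).
  by rewrite rmorph1 mul1r mulrAC mulfV ?nz // mul1r.
by apply: mem_mulmod => //; exists 1, w.
Qed.

Lemma common_denominator Q E (T : eqType) (l : seq T) (f : T -> K) :
  prime_ideal Q -> D_submodule E ->
  (forall p, p \in l -> saturation Q E (f p)) ->
  exists2 w : D, ~ Q w & forall p, p \in l -> E (w%:K * f p).
Proof.
move=> pQ subE; elim: l => [|p l IH] lE; first by exists 1 => //; exact: prime_not1.
have [|w Qw wE] := IH; first by move=> q ql; apply: lE; rewrite inE ql orbT.
have [v Qv vE] := lE p (mem_head _ _).
exists (v * w); first exact: primeM.
move=> q; rewrite inE => /orP[/eqP->|/wE Eq].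
  have -> : (v * w)%:K * f p = w%:K * (v%:K * f p) by ring.
  exact: submodM.
by rewrite rmorphM -mulrA; exact: submodM.
Qed.

(** The finite witnesses of the elements of [l] are concatenated; monotonicity of [R] keeps each of
    them valid. *)
Lemma collect (T : eqType) (J : set D) (R : T -> set D -> Prop) (l : seq T) :
  (forall d s t, {subset s <= t} -> R d (gen s) -> R d (gen t)) ->
  (forall d, d \in l -> exists2 s, (forall y, y \in s -> J y) & R d (gen s)) ->
  exists2 s, (forall y, y \in s -> J y) & forall d, d \in l -> R d (gen s).
Proof.
move=> monoR; elim: l => [|d l IH] lR; first by exists [::].
have [|s sJ sR] := IH; first by move=> e el; apply: lR; rewrite inE el orbT.
have [t tJ tR] := lR d (mem_head _ _); exists (s ++ t).
  by move=> y; rewrite mem_cat => /orP[/sJ|/tJ].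
move=> e; rewrite inE => /orP[/eqP->|el].
  by apply: monoR tR => y yt; rewrite mem_cat yt orbT.
by apply: (monoR _ s) (sR e el) => y ys; rewrite mem_cat ys.
Qed.

End Ideals.
(** * Closures of ideals *)

Section StarClosure.
Local Open Scope classical_set_scope.
Local Open Scope ring_scope.
Variable D : idomainType.
Local Notation K := {fraction D}.
Local Notation "x %:K" := (tofrac x : K) (at level 2, left associativity).
Variable star : set K -> set K.
Hypothesis hstar : semistar star.
Implicit Types (I J P Q A : set D) (s t : seq D) (E F : set K).

Lemma star_inKS I J : nonzero_ideal I -> is_ideal J -> I `<=` J ->
  star (inK I) `<=` star (inK J).
Proof.
move=> nzI idJ IJ; case: hstar => _ _ mono _ _; apply: mono.
- exact: inK_Fbar.
- exact/inK_Fbar/(nonzero_idealS idJ nzI).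
- exact: inKS.
Qed.

Lemma star_submod I : nonzero_ideal I -> D_submodule (star (inK I)).
Proof. by move=> nzI; case: hstar => /(_ _ (inK_Fbar nzI)) []. Qed.

Lemma star_ext I : nonzero_ideal I -> inK I `<=` star (inK I).
Proof. by move=> nzI; case: hstar => _ _ _ ext _; exact/ext/inK_Fbar. Qed.

Lemma star_hull I J : nonzero_ideal I -> nonzero_ideal J ->
  inK I `<=` star (inK J) -> star (inK I) `<=` star (inK J).
Proof.
move=> /inK_Fbar FI /inK_Fbar FJ IJ; case: hstar => clos _ mono _ idem.
by rewrite -[star (inK J)]idem //; apply: mono => //; exact: clos.
Qed.

Lemma star_hull_gen s J : nonzero_ideal (gen s) -> nonzero_ideal J ->
  (forall d, d \in s -> star (inK J) d%:K) -> star (inK (gen s)) `<=` star (inK J).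
Proof.
move=> nzs nzJ sJ; apply: star_hull => // _ [a sa <-].
apply: (@gen_sub _ _ [set a | star (inK J) a%:K]) sa => //.
exact/submod_preimage/star_submod.
Qed.

(** By the scaling axiom, [u] times the closure of (s) is the closure of u(s), which monotonicity
    places in the closure of (t). *)
Lemma star_gen_mul (u : K) s t x : u != 0 -> nonzero_ideal (gen s) ->
  (forall d, d \in s -> inK (gen t) (u * d%:K)) ->
  star (inK (gen s)) x -> nonzero_ideal (gen t) /\ star (inK (gen t)) (u * x).
Proof.
move=> u0 nzs ust sx.
have sub_us : scale u (inK (gen s)) `<=` inK (gen t).
  have : gen s `<=` [set a | inK (gen t) (u * a%:K)].
    by apply: gen_sub => //; exact/submod_scaled_preimage/inK_submod/gen_ideal.
  by move=> sub _ [_ [a sa <-] <-]; exact: sub.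
have Fus : Fbar (scale u (inK (gen s))).
  have [[s0 sL] [y sy y0]] := inK_Fbar nzs; split.
    split; first by exists 0; rewrite ?mulr0.
    by move=> a _ _ [p sp <-] [q sq <-]; exists (a%:K * p + q); [exact: sL|ring].
  by exists (u * y); [exists y|rewrite mulf_neq0].
have nzt : nonzero_ideal (gen t).
  split; first exact: gen_ideal.
  have [_ [y usy y0]] := Fus; have [a ta ay] := sub_us _ usy.
  by exists a => //; rewrite -tofrac_eq0 ay.
split=> //; case: hstar => _ scal mono _ _.
apply: mono sub_us _ _ => //; first exact: inK_Fbar.
by rewrite scal //; [exists x|exact: inK_Fbar].
Qed.

(* [finite_closure J] is the trace on [D] of [J^{star_f}]. *)
Definition finite_closure J : set D := [set a | exists s,
  [/\ forall d, d \in s -> J d, nonzero_ideal (gen s) & star (inK (gen s)) a%:K]].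
Local Notation cl := finite_closure.

Lemma finite_closureS I J : I `<=` J -> cl I `<=` cl J.
Proof. by move=> IJ a [s [sI nzs sa]]; exists s; split=> // d /sI /IJ. Qed.

Lemma star_fE J x : is_ideal J -> star_f star (inK J) x <-> exists s,
  [/\ forall d, d \in s -> J d, nonzero_ideal (gen s) & star (inK (gen s)) x].
Proof.
move=> idJ; split=> [[F [fgF /(fg_gen fgF) [s [sJ nzs ->]]] sx]|[s [sJ nzs sx]]].
  by exists s.
exists (inK (gen s)) => //; split; first exact: gen_fg.
by apply: inKS; exact: gen_sub.
Qed.

Lemma sub_finite_closure J : nonzero_ideal J -> J `<=` cl J.
Proof.
(* [b] keeps the generated ideal nonzero when [a] is 0. *)
move=> [idJ [b Jb b0]] a Ja; exists [:: a; b].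
have nz : nonzero_ideal (gen [:: a; b]).
  by apply/gen_nonzero; exists b; rewrite // !inE eqxx orbT.
split=> // [d|]; first by rewrite !inE => /orP[/eqP->|/eqP->].
by apply: star_ext => //; exists a => //; apply: mem_gen; rewrite mem_head.
Qed.

Lemma finite_closure_star J : nonzero_ideal J ->
  cl J `<=` [set a | star (inK J) a%:K].
Proof.
move=> [idJ _] a [s [sJ nzs sa]]; apply: star_inKS sa => //.
exact: gen_sub.
Qed.

Lemma nonzero_gen_catl s t : nonzero_ideal (gen s) -> nonzero_ideal (gen (s ++ t)).
Proof.
move=> nzs; apply: nonzero_idealS nzs _; first exact: gen_ideal.
by apply: gen_subseq => y ys; rewrite mem_cat ys.
Qed.

Lemma finite_closure_ideal J : nonzero_ideal J -> is_ideal (cl J).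
Proof.
move=> nzJ; split.
  by apply: sub_finite_closure => //; case: nzJ => -[].
move=> a x y [s [sJ nzs sx]] [t [tJ nzt ty]]; exists (s ++ t).
have nzst := nonzero_gen_catl t nzs.
split=> // [d|]; first by rewrite mem_cat => /orP[/sJ|/tJ].
rewrite rmorphD rmorphM; case: (star_submod nzst) => _; apply.
  apply: star_inKS sx => //; first exact: gen_ideal.
  by apply: gen_subseq => z zs; rewrite mem_cat zs.
apply: star_inKS ty => //; first exact: gen_ideal.
by apply: gen_subseq => z zs; rewrite mem_cat zs orbT.
Qed.

Lemma finite_closure_nonzero J : nonzero_ideal J -> nonzero_ideal (cl J).
Proof.
move=> nzJ; apply: (nonzero_idealS (finite_closure_ideal nzJ) nzJ).
exact: sub_finite_closure.
Qed.

Lemma finite_closure_idem J : nonzero_ideal J -> cl (cl J) `<=` cl J.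
Proof.
move=> nzJ a [s [sJ nzs sa]].
have [t tJ tR] : exists2 t, (forall y, y \in t -> J y) &
    forall d, d \in s -> nonzero_ideal (gen t) /\ star (inK (gen t)) d%:K.
  apply: (@collect _ _ J (fun d I => nonzero_ideal I /\ star (inK I) d%:K)).
    move=> d s' t' st [nz sd]; have nzt : nonzero_ideal (gen t').
      by apply: nonzero_idealS nz _; [exact: gen_ideal|exact: gen_subseq].
    split=> //; apply: star_inKS sd => //; first exact: gen_ideal.
    exact: gen_subseq.
  by move=> d /sJ [t [tJ nzt td]]; exists t.
have nzt : nonzero_ideal (gen t).
  by have /gen_nonzero [d ds _] := nzs; case: (tR d ds).
exists t; split=> //; apply: star_hull_gen sa => // d ds.
by case: (tR d ds).
Qed.

Lemma star_fT_1 : star_f star (DinK D) 1.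
Proof.
apply/star_fE => //; exists [:: 1].
have nz1 : nonzero_ideal (gen [:: 1 : D]).
  by apply/gen_nonzero; exists 1; rewrite ?mem_head ?oner_neq0.
split=> //; apply: star_ext => //; exists 1; rewrite ?rmorph1 //.
by apply: mem_gen; rewrite mem_head.
Qed.

(** Once 1 lies in the closure of (s), all of [D] does, and with it the closure of every finitely
    generated ideal. *)
Lemma star_f_unit A : nonzero_ideal A ->
  star_f star (inK A) = star_f star (DinK D) <-> cl A 1.
Proof.
move=> nzA; have idA : is_ideal A by case: nzA.
split=> [eqA|[s [sA nzs s1]]].
  by have := star_fT_1; rewrite -eqA => /star_fE -/(_ idA); rewrite -(rmorph1 (@tofrac D)).
apply/seteqP; split=> x.
  by move=> /star_fE -/(_ idA) [t [_ nzt tx]]; apply/star_fE => //; exists t.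
move=> /star_fE -/(_ (proj1 (nonzero_idealT D))) [t [_ nzt tx]].
apply/star_fE => //; exists s; split=> //; apply: star_hull_gen tx => // d _.
rewrite -[d]mulr1 rmorphM; apply: submodM => //; exact: star_submod.
Qed.

Lemma quasi_star_fE J : quasi_ideal (star_f star) J <->
  nonzero_ideal J /\ cl J `<=` J.
Proof.
split=> [[nzJ eJ]|[nzJ clJ]]; split=> //.
  by move=> a Ja; rewrite eJ; apply/star_fE => //; case: nzJ.
apply/seteqP; split=> a.
  by move=> /(sub_finite_closure nzJ) Ja; apply/star_fE => //; case: nzJ.
by move=> /star_fE -/(_ (proj1 nzJ)); exact: clJ.
Qed.

Lemma finite_closure_bigcup (C : set (set D)) : C !=set0 -> total_on C subset ->
  cl (\bigcup_(I in C) I) `<=` \bigcup_(I in C) cl I.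
Proof.
move=> C0 totC a [s [sC nzs sa]]; have [I CI sI] := seq_in_chain C0 totC sC.
by exists I => //; exists s.
Qed.

(** * Quasi-maximal ideals and the closure by localization *)

Local Notation M := (quasi_maximal (star_f star)).

Lemma quasi_maximal_ideal Q : M Q -> [/\ nonzero_ideal Q, cl Q `<=` Q & ~ Q 1].
Proof.
move=> [/quasi_star_fE [nzQ clQ] QT _]; split=> //.
by apply: prime1 => //; case: nzQ.
Qed.

(** Zorn among the proper closed ideals, starting from [cl J]. Unions of chains stay closed because
    [cl] only looks at finite subsets. *)
Lemma quasi_maximal_above J : nonzero_ideal J -> ~ cl J 1 ->
  exists2 Q, M Q & J `<=` Q.
Proof.
move=> nzJ J1.
have [||Q [[nzQ Q1 clQ] JQ maxQ]] :=
    @maximal_above _ [set I | [/\ nonzero_ideal I, ~ I 1 & cl I `<=` I]] (cl J).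
- split=> //; [exact: finite_closure_nonzero|exact: finite_closure_idem].
- move=> C C0 CP totC; split.
  + have [I CI] := C0; have [nzI _ _] := CP I CI.
    apply: nonzero_idealS nzI _; last by move=> x Ix; exists I.
    by apply: bigcup_ideal => // E /CP [[]].
  + by move=> [I CI I1]; case: (CP I CI).
  + move=> a /(finite_closure_bigcup C0 totC) [I CI Ia].
    by exists I => //; case: (CP I CI) => _ _; apply.
exists Q; last by move=> a Ja; apply/JQ/sub_finite_closure.
split; first by apply/quasi_star_fE.
  by move=> eQ; apply: Q1; rewrite eQ.
move=> E /quasi_star_fE [nzE clE] ET QE; apply: maxQ => //; split=> //.
by apply: prime1 ET; case: nzE.
Qed.

(** Let [a * b] be in Q with [a], [b] outside. By maximality 1 lies in the closure of A = Q + aD;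
    multiplying by [b] puts [b] in the closure of bA, which is contained in Q. *)
Lemma quasi_maximal_prime Q : M Q -> prime_ideal Q.
Proof.
move=> MQ; have [nzQ clQ Q1] := quasi_maximal_ideal MQ; have [_ QT maxQ] := MQ.
have idQ : is_ideal Q by case: nzQ.
split=> // a b Qab; apply: contrapT => nQ.
have [Qa Qb] : ~ Q a /\ ~ Q b by split=> H; apply: nQ; [left|right].
pose A := [set x | exists q d, Q q /\ x = q + d * a].
have idA : is_ideal A.
  split; first by exists 0, 0; split; [case: idQ|ring].
  move=> c _ _ [q [d [Qq ->]]] [r [e [Qr ->]]].
  by exists (c * q + r), (c * d + e); split; [case: idQ => _; apply|ring].
have QA : Q `<=` A by move=> q Qq; exists q, 0; split; [|ring].
have nzA := nonzero_idealS idA nzQ QA.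
have [A1|/(quasi_maximal_above nzA) [N MN AN]] := pselect (cl A 1); last first.
  apply: Qa; have [qN NT _] := MN.
  by rewrite -(maxQ N) // => [|x /QA/AN //]; apply: AN; exists 0, 1; split; [case: idQ|ring].
have b0 : b%:K != 0.
  by rewrite tofrac_eq0; apply/eqP => b0; apply: Qb; rewrite b0; case: idQ.
apply: Qb; apply: clQ; have [s [sA nzs s1]] := A1.
have [|nzt tb] := @star_gen_mul b%:K s [seq b * d | d <- s] _ b0 nzs _ s1.
  by move=> d ds; exists (b * d); [by apply: mem_gen; apply: map_f|rewrite rmorphM].
exists [seq b * d | d <- s]; split=> //; last by rewrite rmorph1 mulr1 in tb.
move=> _ /mapP[d /sA [q [e [Qq ->]]] ->].
have -> : b * (q + e * a) = b * q + e * (a * b) by ring.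
by apply: idealD => //; exact: idealM.
Qed.

(** The hypothesis forces 1 into [cl A]. A finite witness [s] of this lies in no Q, as otherwise 1
    would be in [cl Q], that is in Q. *)
Lemma cover_finite A : nonzero_ideal A ->
  (forall Q, M Q -> exists2 x, A x & ~ Q x) ->
  exists s, [/\ forall d, d \in s -> A d, nonzero_ideal (gen s),
    star (inK (gen s)) 1 & forall Q, M Q -> exists2 d, d \in s & ~ Q d].
Proof.
move=> nzA cov.
have [[s [sA nzs s1]]|/(quasi_maximal_above nzA) [Q MQ AQ]] := pselect (cl A 1).
  exists s; split=> // Q MQ.
  have [_ clQ Q1] := quasi_maximal_ideal MQ.
  apply: contrapT => nsQ; apply/Q1/clQ; exists s; split=> // d ds.
  by apply: contrapT => Qd; apply: nsQ; exists d.
by have [x Ax] := cov Q MQ; case; exact: AQ.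
Qed.

Lemma finite_closure_1 A : nonzero_ideal A ->
  cl A 1 <-> forall Q, M Q -> exists2 x, A x & ~ Q x.
Proof.
move=> nzA; split=> [A1 Q MQ|/(cover_finite nzA) [s [sA nzs s1 _]]].
  have [_ clQ Q1] := quasi_maximal_ideal MQ.
  apply: contrapT => nAQ; apply/Q1/clQ; apply: finite_closureS A1 => x Ax.
  by apply: contrapT => Qx; apply: nAQ; exists x.
by exists s; split=> //; rewrite rmorph1.
Qed.

(* [tilde J] is the trace on [D] of [J^{star_tilde}], see [star_tilde_inK]. *)
Definition tilde J : set D :=
  [set a | forall Q, M Q -> exists2 w, ~ Q w & J (w * a)].

Lemma star_tildeE E x : D_submodule E ->
  star_tilde star E x <-> forall Q, M Q -> saturation Q E x.
Proof.
move=> subE; split=> tE Q MQ; have := tE Q MQ;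
  by rewrite mulmod_localization //; exact: quasi_maximal_prime.
Qed.

Lemma star_tilde_inK J a : is_ideal J ->
  star_tilde star (inK J) a%:K <-> tilde J a.
Proof.
move=> idJ; split.
  move=> /star_tildeE -/(_ (inK_submod idJ)) tJ Q /tJ [w Qw].
  by rewrite -rmorphM => /inKE; exists w.
move=> tJ; apply/star_tildeE; first exact: inK_submod.
by move=> Q /tJ [w Qw Jwa]; exists w => //; rewrite -rmorphM; exact/inKE.
Qed.

Lemma tilde_ideal J : is_ideal J -> is_ideal (tilde J).
Proof.
move=> idJ; split=> [Q MQ|a x y tx ty Q MQ].
  by exists 1; [exact/prime_not1/quasi_maximal_prime|rewrite mulr0; case: idJ].
have [[v Qv Jx] [w Qw Jy]] := (tx Q MQ, ty Q MQ).
exists (v * w); first by apply: primeM => //; exact: quasi_maximal_prime.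
have -> : v * w * (a * x + y) = (a * w) * (v * x) + v * (w * y) by ring.
by apply: idealD => //; exact: idealM.
Qed.

Lemma sub_tilde J : J `<=` tilde J.
Proof.
move=> a Ja Q MQ; exists 1; last by rewrite mul1r.
exact/prime_not1/quasi_maximal_prime.
Qed.

Lemma tildeS I J : I `<=` J -> tilde I `<=` tilde J.
Proof. by move=> IJ a ta Q /ta [w Qw Iwa]; exists w => //; exact: IJ. Qed.

Lemma tilde_idem J : tilde (tilde J) `<=` tilde J.
Proof.
move=> a ta Q MQ; have [v Qv tva] := ta Q MQ; have [w Qw Jwva] := tva Q MQ.
by exists (w * v); [apply: primeM => //; exact: quasi_maximal_prime|rewrite -mulrA].
Qed.

(** [cover_finite] for the ideal of all x with x a in [J], which is nonzero because it contains
    [J]. *)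
Lemma tilde_cover J a : nonzero_ideal J -> tilde J a ->
  exists s, [/\ forall d, d \in s -> J (d * a), nonzero_ideal (gen s),
    star (inK (gen s)) 1 & forall Q, M Q -> exists2 d, d \in s & ~ Q d].
Proof.
move=> [idJ [b Jb b0]] ta.
apply: (@cover_finite [set x | J (x * a)]) => [|Q /ta [w Qw Jwa]];
  last by exists w.
split; last by exists b => //=; rewrite mulrC; exact: idealM.
split=> [|c x y] /=; first by rewrite mul0r; case: idJ.
have -> : (c * x + y) * a = c * (x * a) + y * a by ring.
by case: idJ => _; apply.
Qed.

Lemma tilde_finite J a : nonzero_ideal J -> tilde J a ->
  exists2 s, (forall d, d \in s -> J d) & tilde (gen s) a.
Proof.
move=> nzJ /(tilde_cover nzJ) [s [sJ nzs s1 cov]].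
exists [seq d * a | d <- s]; first by move=> _ /mapP[d /sJ ? ->].
by move=> Q /cov [d ds Qd]; exists d => //; apply: mem_gen; exact: map_f.
Qed.

(** Multiply the list of [tilde_cover], whose closure contains 1, by [a]: the products lie in [J]
    and their closure contains [a]. *)
Lemma tilde_sub_finite_closure J : nonzero_ideal J -> tilde J `<=` cl J.
Proof.
move=> nzJ a ta; have [s [sJ nzs s1 _]] := tilde_cover nzJ ta.
have [->|a0] := eqVneq a 0; first by case: (finite_closure_ideal nzJ).
have aK0 : a%:K != 0 by rewrite tofrac_eq0.
have [|nzt tb] := @star_gen_mul a%:K s [seq d * a | d <- s] 1 aK0 nzs _ s1.
  move=> d ds; exists (d * a); first by apply: mem_gen; apply: map_f.
  by rewrite rmorphM mulrC.
exists [seq d * a | d <- s]; rewrite mulr1 in tb; split=> //.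
by move=> _ /mapP[d /sJ ? ->].
Qed.

(** * Invertibility at the quasi-maximal ideals *)

(** I(D : I) is an ideal [A] of [D], so the condition says that [A] lies in no Q; a sum of products
    outside Q has a summand outside Q. *)
Lemma star_invertible_local I : nonzero_ideal I ->
  star_invertible (star_f star) I <-> forall Q, M Q -> exists i u d,
    [/\ I i, colon (DinK D) (inK I) u, i%:K * u = d%:K & ~ Q d].
Proof.
move=> nzI; have idI : is_ideal I by case: nzI.
pose E := mulmod (inK I) (colon (DinK D) (inK I)).
have subE : D_submodule E by exact/mulmod_submod/inK_submod.
pose A := [set a : D | E a%:K].
have eqE : E = inK A.
  apply/seteqP; split=> [x Ex|_ [a Aa <-] //].
  have [d xd] : exists d : D, x = d%:K.
    apply/DinKE; apply: mulmod_sub Ex; first exact: DinK_submod.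
    by move=> _ u [i Ii <-] /colonP /(_ i Ii); rewrite mulrC.
  by rewrite xd; exists d; rewrite /A /= -?xd.
have IA : I `<=` A.
  move=> i Ii; rewrite /A /= -[i%:K]mulr1; apply: mem_mulmod; first by exists i.
  by apply/colonP => j _; rewrite mul1r; exists j.
have idA : is_ideal A by exact: submod_preimage.
have nzA := nonzero_idealS idA nzI IA.
rewrite /star_invertible -/E eqE star_f_unit // finite_closure_1 //.
split=> H Q MQ; have [nzQ _ _] := quasi_maximal_ideal MQ; have idQ := proj1 nzQ.
  have [a Aa Qa] := H Q MQ; apply: contrapT => nex; apply: Qa; apply/inKE.
  apply: mulmod_sub Aa; first exact: inK_submod.
  move=> _ u [i Ii <-] uI; have /DinKE [d iud] : DinK D (i%:K * u).
    by rewrite mulrC; move/colonP: uI; apply.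
  rewrite iud; apply/inKE; apply: contrapT => Qd; apply: nex.
  by exists i, u, d.
have [i [u [d [Ii uI iud Qd]]]] := H Q MQ; exists d => //.
by rewrite /A /= -iud; apply: mem_mulmod => //; exists i.
Qed.

Local Notation Dt := (star_tilde star (DinK D)).

Lemma tilde_DinK x : Dt x <-> forall Q, M Q -> saturation Q (DinK D) x.
Proof. exact/star_tildeE/DinK_submod. Qed.

(** [E] is locally contained in [D], so equality of the closures only requires 1 to be in E D_Q for
    every Q. *)
Lemma quasi_invertible_local P : is_ideal P ->
  quasi_invertible (star_tilde star) (inK P) <->
  forall Q, M Q -> saturation Q (mulmod (inK P) (colon Dt (inK P))) 1.
Proof.
move=> idP; set E := mulmod _ _.
have subE : D_submodule E by exact/mulmod_submod/inK_submod.
have EDt x : E x -> forall Q, M Q -> saturation Q (DinK D) x.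
  move=> Ex Q MQ; apply: mulmod_sub Ex.
    by apply: saturation_submod; [exact: quasi_maximal_prime|exact: DinK_submod].
  by move=> _ u [p Pp <-] /colonP /(_ p Pp) /tilde_DinK; rewrite mulrC; apply.
rewrite /quasi_invertible -/E; split=> [eqE Q MQ|E1].
  suff : star_tilde star E 1 by move=> /star_tildeE; apply.
  rewrite eqE; apply/tilde_DinK => N /quasi_maximal_prime pN.
  by apply: saturation_id => //; exists 1; rewrite ?rmorph1.
apply/seteqP; split=> x.
  move=> /(star_tildeE _ subE) Ex; apply/tilde_DinK => Q MQ.
  have [w Qw Ewx] := Ex Q MQ; have [v Qv [d _ dx]] := EDt _ Ewx Q MQ.
  exists (v * w); first by apply: primeM => //; exact: quasi_maximal_prime.
  by exists d => //; rewrite dx; ring.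
move=> /tilde_DinK Dx; apply/star_tildeE => // Q MQ.
have [[v Qv Ev] [w Qw [d _ dx]]] := (E1 Q MQ, Dx Q MQ).
exists (v * w); first by apply: primeM => //; exact: quasi_maximal_prime.
have -> : (v * w)%:K * x = d%:K * (v%:K * 1) by rewrite dx; ring.
exact: submodM.
Qed.

(** * From the Dedekind condition to invertible primes *)

(** Otherwise generators from [P] can be added forever, each outside the closure of the previous
    ones, and the traces of these closures never stabilize. *)
Lemma star_noetherian_finite P : star_noetherian star -> nonzero_ideal P ->
  exists s, [/\ forall d, d \in s -> P d, nonzero_ideal (gen s) &
    forall p, P p -> star (inK (gen s)) p%:K].
Proof.
move=> noeth [idP [a Pa a0]]; apply: contrapT => nfin.
(* Keeping [a] in every list makes all the generated ideals nonzero. *)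
pose good s := (forall d, d \in s -> P d) /\ a \in s.
have good_nz s : good s -> nonzero_ideal (gen s).
  by move=> [_ sa]; apply/gen_nonzero; exists a.
have /choice [next nextP] : forall s, exists p, good s ->
    P p /\ ~ star (inK (gen s)) p%:K.
  move=> s.
  (* On lists that are not [good] the value 0 is a dummy. *)
  have [gs|ngs] := pselect (good s); last by exists 0.
  apply: contrapT => nex; apply: nfin; exists s.
  split; [by case: gs|exact: good_nz|move=> p Pp].
  by apply: contrapT => sp; apply: nex; exists p.
pose f n := iter n (fun s => next s :: s) [:: a].
have fG n : good (f n).
  elim: n => [|n [fP fa]]; first by split=> [d|]; rewrite inE // => /eqP ->.
  split=> [d|]; last by rewrite inE fa orbT.
  by rewrite inE => /orP[/eqP->|/fP //]; case: (nextP _ (conj fP fa)).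
have fN n := good_nz _ (fG n).
have fS n : gen (f n) `<=` gen (f n.+1).
  by apply: gen_subseq => y ys; rewrite inE ys orbT.
pose I n := [set d : D | star (inK (gen (f n))) d%:K].
have idI n : is_ideal (I n) by exact/submod_preimage/star_submod.
have fI n : gen (f n) `<=` I n.
  by move=> d fd; apply: star_ext => //; exists d.
have nzI n : nonzero_ideal (I n) := nonzero_idealS (idI n) (fN n) (fI n).
have [||n stab] := noeth I.
- move=> n; split=> //; apply/seteqP; split=> d Id.
    by apply: star_ext => //; exists d.
  by apply: (star_hull (nzI n) (fN n)) Id => _ [e Ie <-].
- by move=> n d; apply: star_inKS => //; exact: gen_ideal.
have [_ sn] := nextP _ (fG n); apply: sn.
have : I n.+1 (next (f n)) by apply: fI; apply: mem_gen; rewrite mem_head.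
by rewrite stab.
Qed.

Lemma PstarMD_gen s : PstarMD star -> nonzero_ideal (gen s) ->
  forall Q, M Q -> exists i u d,
    [/\ gen s i, colon (DinK D) (inK (gen s)) u, i%:K * u = d%:K & ~ Q d].
Proof.
by move=> pmd nzs; apply/(star_invertible_local nzs)/pmd => //; exact: gen_fg.
Qed.

(** Invertibility of (p, s) at Q gives [u] with u(p, s) in [D] but not inside Q. If u s were inside
    Q, then u p, which lies in the closure of u(s), would be in Q too. So some u b with [b] in [s]
    is a unit of D_Q, and p = (u p / u b) b there. *)
Lemma star_sub_tilde s p : PstarMD star -> nonzero_ideal (gen s) ->
  star (inK (gen s)) p%:K -> tilde (gen s) p.
Proof.
move=> pmd nzs sp Q MQ.
have [nzQ clQ _] := quasi_maximal_ideal MQ; have idQ := proj1 nzQ.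
have nzps : nonzero_ideal (gen (p :: s)).
  apply: nonzero_idealS nzs _; first exact: gen_ideal.
  by apply: gen_subseq => y ys; rewrite inE ys orbT.
have [i [u [d [psi /colonP uD iud Qd]]]] := PstarMD_gen pmd nzps MQ.
have u0 : u != 0.
  apply/eqP => u0; move: iud; rewrite u0 mulr0 => /esym/eqP.
  by rewrite tofrac_eq0 => /eqP d0; apply: Qd; rewrite d0; case: idQ.
have /DinKE [e upe] : DinK D (u * p%:K).
  by apply: uD; apply: mem_gen; rewrite mem_head.
have memps d' : d' \in s -> gen (p :: s) d'.
  by move=> ds; apply: mem_gen; rewrite inE ds orbT.
(* Does [u] send some generator in [s] outside Q? *)
have [[b [c [bs ubc Qc]]]|us] :=
    pselect (exists b c, [/\ b \in s, u * b%:K = c%:K & ~ Q c]).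
  exists c => //; have -> : c * p = e * b.
    by apply/eqP; rewrite -tofrac_eq !tofracM -ubc -upe; apply/eqP; ring.
  exact: (idealM _ (gen_ideal s) (mem_gen bs)).
have {}us b : b \in s -> inK Q (u * b%:K).
  move=> bs; have /DinKE [c ubc] := uD b (memps b bs).
  by rewrite ubc; apply/inKE; apply: contrapT => Qc; apply: us; exists b, c.
have [t tQ ut] : exists2 t, (forall y, y \in t -> Q y) &
    forall b, b \in s -> inK (gen t) (u * b%:K).
  apply: (@collect _ _ Q (fun b I => inK I (u * b%:K))).
    by move=> b s' t' st; apply: inKS; exact: gen_subseq.
  move=> b /us [c Qc <-]; exists [:: c]; first by move=> y; rewrite inE => /eqP ->.
  by apply/inKE; apply: mem_gen; rewrite mem_head.
(* The elements u b have finitely many generators [t] in Q, so [e], which is u p, is in [cl Q]. *)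
have [nzt te] := star_gen_mul u0 nzs ut sp.
have Qe : Q e by apply: clQ; exists t; rewrite -upe.
case: Qd; apply/inKE; rewrite -iud mulrC.
apply: (gen_sub (submod_scaled_preimage u (inK_submod idQ))) psi => b.
by rewrite inE => /orP[/eqP->|/us //]; exists e; rewrite ?upe.
Qed.

Lemma dedekind_prime_invertible P : star_dedekind star -> nonzero_ideal P ->
  quasi_invertible (star_tilde star) (inK P).
Proof.
move=> [noeth pmd] nzP; have [s [sP nzs Ps]] := star_noetherian_finite noeth nzP.
have idP := proj1 nzP.
apply/quasi_invertible_local => // Q MQ.
have [i [u [d [si /colonP uD iud Qd]]]] := PstarMD_gen pmd nzs MQ.
exists d => //; rewrite mulr1 -iud; apply: mem_mulmod.
  by exists i => //; exact: (gen_sub idP sP).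
(* Here (D : s) is seen to be contained in (D^tilde : P): locally [p] is in (s), so u p is locally
   in [D]. *)
apply/colonP => p /Ps /(star_sub_tilde pmd nzs) sp; apply/tilde_DinK => N MN.
have [w Nw /uD] := sp N MN; exists w => //.
by rewrite mulrCA -rmorphM.
Qed.

(** * Consequences of the invertibility of primes *)

Definition tilde_fg J : Prop :=
  exists2 s, (forall d, d \in s -> J d) & J `<=` tilde (gen s).

Lemma tilde_bigcup (C : set (set D)) : C !=set0 -> total_on C subset ->
  (forall I, C I -> nonzero_ideal I) ->
  tilde (\bigcup_(I in C) I) `<=` \bigcup_(I in C) tilde I.
Proof.
move=> C0 totC nzC a; have [I0 CI0] := C0.
have nzU : nonzero_ideal (\bigcup_(I in C) I).
  apply: nonzero_idealS (nzC _ CI0) _; last by move=> x Ix; exists I0.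
  by apply: bigcup_ideal => // I /nzC [].
move=> /(tilde_finite nzU) [s /(seq_in_chain C0 totC) [I CI sI] sa].
exists I => //; apply: tildeS sa; apply: gen_sub => //.
by case: (nzC I CI).
Qed.

(** The member containing the finitely many generators is closed, hence is the whole union. This
    serves both the Zorn step of Cohen's argument and the chain condition. *)
Lemma tilde_fg_bigcup (C : set (set D)) : C !=set0 -> total_on C subset ->
  (forall I, C I -> is_ideal I) -> (forall I, C I -> tilde I `<=` I) ->
  tilde_fg (\bigcup_(I in C) I) -> exists2 I, C I & \bigcup_(I in C) I = I.
Proof.
move=> C0 totC idC tC [s /(seq_in_chain C0 totC) [I CI sI] Us].
exists I => //; apply/seteqP; split=> x; last by move=> Ix; exists I.
by move=> /Us sx; apply: (tC I CI); apply: tildeS sx; apply: gen_sub => //; exact: idC.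
Qed.

(** Finitely many d in P(D^tilde : P) cover all Q. Write each as a sum of q u with q in [P], and let
    [t] collect the q. For p in [P], d p is the sum of the (u p) q, locally in (t), and at each Q
    some d is a unit. *)
Lemma quasi_invertible_tilde_fg P : is_ideal P ->
  quasi_invertible (star_tilde star) (inK P) -> nonzero_ideal P -> tilde_fg P.
Proof.
move=> idP /(quasi_invertible_local idP) invP nzP.
pose E := mulmod (inK P) (colon Dt (inK P)).
have subE : D_submodule E by exact/mulmod_submod/inK_submod.
pose A := [set a : D | E a%:K].
have PA : P `<=` A.
  move=> p Pp; rewrite /A /= -[p%:K]mulr1; apply: mem_mulmod; first by exists p.
  apply/colonP => q _; apply/tilde_DinK => Q MQ; rewrite mul1r.
  by apply: saturation_id; [exact: quasi_maximal_prime|exists q].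
have nzA : nonzero_ideal A := nonzero_idealS (submod_preimage subE) nzP PA.
have [|s [sA nzs _ cov]] := cover_finite nzA.
  by move=> Q /invP [w Qw]; rewrite mulr1; exists w.
have [t tP tR] : exists2 t, (forall y, y \in t -> P y) &
    forall d, d \in s -> forall p, P p -> tilde (gen t) (d * p).
  apply: (@collect _ _ P (fun d I => forall p, P p -> tilde I (d * p))).
    by move=> d s' t' st sd p /sd; apply: tildeS; exact: gen_subseq.
  move=> d /sA /mulmodP [l [lPu dl]].
  have [t tP tl] : exists2 t, (forall y, y \in t -> P y) &
      forall q, q \in l -> inK (gen t) q.1.
    apply: (@collect _ _ P (fun q I => inK I q.1)).
      by move=> q s' t' st; apply: inKS; exact: gen_subseq.
    move=> q /lPu [[y Py <-] _]; exists [:: y].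
      by move=> z; rewrite inE => /eqP ->.
    by apply/inKE; apply: mem_gen; rewrite mem_head.
  exists t => // p Pp; apply/star_tilde_inK; first exact: gen_ideal.
  have subt := inK_submod (gen_ideal t).
  apply/star_tildeE => // Q MQ; have pQ := quasi_maximal_prime MQ.
  rewrite tofracM dl mulr_suml big_seq.
  apply: (big_ind (saturation Q (inK (gen t)))).
  - by case: (saturation_submod pQ subt).
  - by move=> x y; apply: submodD; exact: saturation_submod.
  move=> q ql; have [_ /colonP /(_ p Pp) /tilde_DinK /(_ Q MQ)] := lPu q ql.
  move=> [w Qw [e _ eq2]]; exists w => //.
  have -> : w%:K * (q.1 * q.2 * p%:K) = e%:K * q.1 by rewrite eq2; ring.
  by apply: submodM => //; exact: tl.
exists t => // p Pp Q MQ; have [d ds Qd] := cov Q MQ.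
have [w Qw twdp] := tR d ds p Pp Q MQ; exists (w * d); last by rewrite -mulrA.
by apply: primeM => //; exact: quasi_maximal_prime.
Qed.

Hypothesis inv_primes : forall P, quasi_prime (star_tilde star) P ->
  quasi_invertible (star_tilde star) (inK P).

Lemma tilde_prime_invertible P : prime_ideal P -> nonzero_ideal P ->
  tilde P `<=` P -> quasi_invertible (star_tilde star) (inK P).
Proof.
move=> pP nzP tP; apply: inv_primes; split=> //; split=> //.
have idP := proj1 nzP.
by apply/seteqP; split=> a Pa; [apply/star_tilde_inK/sub_tilde|exact/tP/star_tilde_inK].
Qed.

(* Cohen's argument: an ideal maximal among those that are not finitely
   generated up to [tilde] would be prime. *)
Lemma tilde_closed_fg J : nonzero_ideal J -> tilde J `<=` J -> tilde_fg J.
Proof.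
move=> nzJ tJ; apply: contrapT => nfJ.
have [//||P [[nzP tP nfP] _ maxP]] := @maximal_above _
    [set I | [/\ nonzero_ideal I, tilde I `<=` I & ~ tilde_fg I]] J.
  move=> C C0 CP totC.
  have nzC I : C I -> nonzero_ideal I by move=> /CP [].
  have tC I : C I -> tilde I `<=` I by move=> /CP [].
  have [I0 CI0] := C0; split.
  - apply: nonzero_idealS (nzC _ CI0) _; last by move=> x Ix; exists I0.
    by apply: bigcup_ideal => // I /nzC [].
  - move=> a /(tilde_bigcup C0 totC nzC) [I CI tIa]; exists I => //; exact: tC tIa.
  move=> fU; have [I CI eI] := tilde_fg_bigcup C0 totC (fun I CI => proj1 (nzC I CI)) tC fU.
  by case: (CP I CI) => _ _; apply; rewrite -eI.
have idP := proj1 nzP.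
have larger B : is_ideal B -> P `<=` B -> tilde B `<=` B ->
    (exists2 x, B x & ~ P x) -> tilde_fg B.
  move=> idB PB tB [x Bx nPx]; apply: contrapT => nfB; apply: nPx.
  by rewrite -(maxP B) //; split=> //; exact: nonzero_idealS nzP PB.
apply/nfP/quasi_invertible_tilde_fg => //; apply: tilde_prime_invertible => //.
split=> // [PT|a b Pab].
  apply: nfP; exists [:: 1]; first by move=> y; rewrite inE PT.
  move=> x _; apply: sub_tilde; rewrite -[x]mulr1; apply: (idealM x (gen_ideal _)).
  by apply: mem_gen; rewrite mem_head.
apply: contrapT => nab.
have [Pa Pb] : ~ P a /\ ~ P b by split=> H; apply: nab; [left|right].
pose A := [set x | exists p d, P p /\ x = p + d * a].
have idA : is_ideal A.
  split; first by exists 0, 0; split; [case: idP|ring].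
  move=> c _ _ [q [d [Qq ->]]] [r [e [Qr ->]]].
  by exists (c * q + r), (c * d + e); split; [case: idP => _; apply|ring].
have PA : P `<=` A by move=> q Qq; exists q, 0; split; [|ring].
have nzA := nonzero_idealS idA nzP PA.
(* Generators of [tilde A] are only locally in A = P + aD; [tilde_finite] replaces them by elements
   of [A]. *)
have [s sA As] : exists2 s, (forall y, y \in s -> A y) & A `<=` tilde (gen s).
  have [||||t tA At] := larger (tilde A).
  - exact: tilde_ideal.
  - by move=> p /PA /sub_tilde.
  - exact: tilde_idem.
  - by exists a => //; apply: sub_tilde; exists 0, 1; split; [case: idP|ring].
  have [s sA sR] := @collect _ _ A (fun d I => tilde I d) t
    (fun d s' t' st => @tildeS _ _ (gen_subseq st) d)
    (fun d dt => tilde_finite nzA (tA d dt)).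
  exists s => // x /sub_tilde /At tx; apply: tilde_idem; apply: tildeS tx.
  by apply: gen_sub => //; exact/tilde_ideal/gen_ideal.
(* B = (P : a) contains [P] and also [b], so [larger] applies to it as well. *)
pose B := [set x | P (a * x)].
have idB : is_ideal B.
  split=> [|c x y Bx By]; first by rewrite /B /= mulr0; case: idP.
  rewrite /B /=; have -> : a * (c * x + y) = c * (a * x) + a * y by ring.
  by case: idP => _; apply.
have [||||t tB Bt] := larger B.
- exact: idB.
- by move=> p Pp; exact: idealM.
- move=> x tx; apply: tP => Q /tx [w Qw Bwx]; exists w => //.
  by rewrite mulrCA.
- by exists b.
(* [r] collects the components in [P] of the generators of [A]. Then [r] and a t generate [P]
   locally: w x = p + e a with p in (r) forces e into [B], hence locally into (t). *)
have [r rP sr] : exists2 r, (forall y, y \in r -> P y) &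
    forall d, d \in s -> exists p e, gen r p /\ d = p + e * a.
  apply: (@collect _ _ P (fun d I => exists p e, I p /\ d = p + e * a)).
    by move=> d s' t' st [p [e [sp ->]]]; exists p, e; split=> //; exact: gen_subseq sp.
  move=> d /sA [p [e [Pp ->]]]; exists [:: p]; first by move=> y; rewrite inE => /eqP ->.
  by exists p, e; split=> //; apply: mem_gen; rewrite mem_head.
apply: nfP; exists (r ++ [seq a * x | x <- t]).
  by move=> y; rewrite mem_cat => /orP[/rP//|/mapP[x /tB Bx ->]].
set g := gen _; have idg : is_ideal g by exact: gen_ideal.
move=> x Px Q MQ; have [w Qw swx] := As x (PA x Px) Q MQ.
have [p [e [rp wx]]] : exists p e, gen r p /\ w * x = p + e * a.
  move: swx; apply: (@gen_sub _ _ [set z | exists p e, gen r p /\ z = p + e * a]) => //.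
  split; first by exists 0, 0; split; [case: (gen_ideal r)|ring].
  move=> c _ _ [q [d [Qq ->]]] [q' [d' [Qq' ->]]].
  exists (c * q + q'), (c * d + d').
  by split; [case: (gen_ideal r) => _; apply|ring].
have Be : B e.
  rewrite /B /=; have -> : a * e = w * x + (-1) * p by rewrite wx; ring.
  by apply: idealD => //; apply: idealM => //; exact: (gen_sub idP rP).
have [v Qv tve] := Bt e Be Q MQ.
exists (v * w); first by apply: primeM => //; exact: quasi_maximal_prime.
have -> : v * w * x = v * p + a * (v * e) by rewrite -mulrA wx; ring.
apply: (idealD idg).
  apply: (idealM _ idg); apply: gen_subseq rp => y yr.
  by rewrite mem_cat yr.
have idga : is_ideal [set z | g (a * z)].
  split=> [|c y z gy gz] /=; first by rewrite mulr0; case: idg.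
  have -> : a * (c * y + z) = c * (a * y) + a * z by ring.
  by case: idg => _; apply.
apply: (gen_sub idga) tve => y yt; apply: mem_gen.
by rewrite mem_cat map_f ?orbT.
Qed.

(** * The chain condition, and the local rings at quasi-maximal ideals *)

(** The three closures are nested: [tilde J] is in [cl J], which is in the trace of the
    [star]-closure. *)
Lemma quasi_ideal_tilde_closed J : quasi_ideal star J -> tilde J `<=` J.
Proof.
move=> [nzJ eJ] a /(tilde_sub_finite_closure nzJ) /(finite_closure_star nzJ).
by rewrite {2}eJ.
Qed.

Lemma invertible_star_noetherian : star_noetherian star.
Proof.
move=> I qI incI; pose C := [set I n | n in [set: nat]].
have leI m n : (m <= n)%N -> I m `<=` I n.
  by move/subnKC <-; elim: (n - m)%N => [|k IH]; rewrite ?addn0 ?addnS // => x /IH /incI.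
have C0 : C !=set0 by exists (I 0%N), 0%N.
have totC : total_on C subset.
  move=> _ _ [m _ <-] [n _ <-].
  by case: (leqP m n) => [|/ltnW] /leI; [left|right].
have nzC J : C J -> nonzero_ideal J by move=> [n _ <-]; case: (qI n).
have idC J : C J -> is_ideal J by move=> /nzC [].
have tC J : C J -> tilde J `<=` J by move=> [n _ <-]; exact: quasi_ideal_tilde_closed.
have [|_ [n _ <-] eU] := tilde_fg_bigcup C0 totC idC tC.
  apply: tilde_closed_fg.
    have CI0 : C (I 0%N) by exists 0%N.
    apply: nonzero_idealS (nzC _ CI0) _; first exact: bigcup_ideal.
    by move=> x Ix; exists (I 0%N).
  move=> a /(tilde_bigcup C0 totC nzC) [J CJ tJa]; exists J => //; exact: tC tJa.
exists n => m nm; apply/seteqP; split; last exact: leI.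
by move=> x Ix; rewrite -eU; exists (I m) => //; exists m.
Qed.

(* [x] divides [y] in [D_Q]. *)
Definition local_dvd Q x y : Prop := exists2 w, ~ Q w & exists e, w * y = e * x.

(** Some product p u from P(D^tilde : P) is a unit of D_Q, and then x = (u x / u p) p with u x in
    D_Q. *)
Lemma local_principal P Q : M Q -> is_ideal P ->
  quasi_invertible (star_tilde star) (inK P) ->
  exists2 p, P p & forall x, P x -> local_dvd Q p x.
Proof.
move=> MQ idP /(quasi_invertible_local idP) /(_ Q MQ) [s Qs].
rewrite mulr1 => Es; have pQ := quasi_maximal_prime MQ.
have idQ : is_ideal Q by case: pQ.
have [p [u [Pp /colonP uP npu]]] : exists p u, [/\ P p, colon Dt (inK P) u &
    ~ saturation Q (inK Q) (p%:K * u)].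
  apply: contrapT => nex.
  have : saturation Q (inK Q) s%:K.
    apply: mulmod_sub Es; first exact/saturation_submod/inK_submod.
    by move=> _ u [p Pp <-] uP; apply: contrapT => npu; apply: nex; exists p, u.
  by move=> [w Qw]; rewrite -rmorphM => /inKE; exact: primeM.
have [w Qw [d _ wup]] := proj1 (tilde_DinK _) (uP p Pp) Q MQ.
have Qd : ~ Q d.
  move=> Qd; apply: npu; exists w => //.
  by rewrite [_ * u]mulrC -wup; exists d.
exists p => // x Px; have [v Qv [e _ vux]] := proj1 (tilde_DinK _) (uP x Px) Q MQ.
exists (v * d); first exact: primeM.
exists (w * e); apply/eqP; rewrite -tofrac_eq !tofracM wup vux; apply/eqP; ring.
Qed.

Lemma local_dvd_total Q x y : M Q -> local_dvd Q x y \/ local_dvd Q y x.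
Proof.
move=> MQ; have pQ := quasi_maximal_prime MQ.
have [nzQ clQ Q1] := quasi_maximal_ideal MQ; have idQ := proj1 nzQ.
have tQ : tilde Q `<=` Q by move=> a /(tilde_sub_finite_closure nzQ) /clQ.
have [r Qr rdvd] := local_principal MQ idQ (tilde_prime_invertible pQ nzQ tQ).
have r0 : r != 0.
  apply/eqP => r0; have [_ [a Qa /eqP]] := nzQ; apply.
  have [w Qw [e]] := rdvd a Qa; rewrite r0 mulr0 => /eqP.
  by rewrite mulf_eq0 => /orP[/eqP w0|/eqP//]; case: Qw; rewrite w0; case: idQ.
(* [x] is a unit of [D_Q] times a power of [r]. *)
pose unitform x := exists (n : nat) (s d : D), [/\ ~ Q s, ~ Q d & s * x = d * r ^+ n].
pose N := [set x | forall n, local_dvd Q (r ^+ n) x].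
(* Induction on the exponent: if z = e r^n in D_Q and [z] is no unit times a power of [r], then [e]
   is in Q, so [r] divides it once more. *)
have N_or_unit z : N z \/ unitform z.
  have [?|nu] := pselect (unitform z); [by right|left; elim=> [|n [w Qw [e wz]]]].
    by exists 1 => //; exists z; rewrite mul1r expr0 mulr1.
  have [/rdvd [v Qv [f ve]]|Qe] := pselect (Q e); last by case: nu; exists n, w, e.
  exists (v * w); first exact: primeM.
  by exists f; rewrite -mulrA wz mulrA ve exprS mulrA.
have unit_notN z : unitform z -> ~ N z.
  move=> [n [s [d [Qs Qd sz]]]] /(_ n.+1) [w Qw [e wz]].
  apply: (primeM pQ Qw Qd); suff -> : w * d = (s * e) * r by exact: idealM.
  apply: (mulIf (expf_neq0 n r0)).
  by rewrite -mulrA -sz mulrCA wz exprS; ring.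
have unitM z z' : unitform z -> unitform z' -> unitform (z * z').
  move=> [n [s [d [Qs Qd sz]]]] [n' [s' [d' [Qs' Qd' sz']]]].
  exists (n + n')%N, (s * s'), (d * d'); split; [exact: primeM|exact: primeM|].
  by rewrite mulrACA sz sz' exprD; ring.
have unit_notQ z : ~ Q z -> unitform z.
  by move=> Qz; exists 0%N, 1, z; rewrite expr0 mulr1 mul1r.
have idN : is_ideal N.
  split=> [n|a z z' Nz Nz' n]; first by exists 1 => //; exists 0; rewrite mulr0 mul0r.
  have [[v Qv [e ve]] [w Qw [f wf]]] := (Nz n, Nz' n).
  exists (v * w); first exact: primeM.
  exists (a * w * e + v * f); rewrite mulrDl -!mulrA -ve -wf; ring.
(* The complement of [N] consists of the unit forms, which are closed under products. *)
have pN : prime_ideal N.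
  split=> // [NT|a b Nab].
    by apply: (unit_notN 1); [exact: unit_notQ|rewrite NT].
  have [Na|ua] := N_or_unit a; first by left.
  have [Nb|ub] := N_or_unit b; first by right.
  by case: (unit_notN _ (unitM _ _ ua ub)).
have tN : tilde N `<=` N.
  move=> a /(_ Q MQ) [w Qw Nwa]; have [//|ua] := N_or_unit a.
  by case: (unit_notN _ (unitM _ _ (unit_notQ _ Qw) ua)).
(* Otherwise [N] is invertible, so [N D_Q] is principal, but [N = r N] in [D_Q]. *)
have N0 z : N z -> z = 0.
  move=> Nz; apply: contrapT => /eqP z0.
  have nzN : nonzero_ideal N by split=> //; exists z.
  have [p Np pdvd] := local_principal MQ idN (tilde_prime_invertible pN nzN tN).
  have p0 : p != 0.
    apply/eqP => p0; have [w Qw [e]] := pdvd z Nz; rewrite p0 mulr0 => /eqP.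
    by rewrite mulf_eq0 (negPf z0) orbF => /eqP w0; apply: Qw; rewrite w0; case: idQ.
  have [s Qs [e sp]] := Np 1%N; rewrite expr1 in sp.
  (* As [r] is a unit form, e r in [N] forces [e] into [N]. Then [p] divides [e] locally, and
     cancelling [p] puts a product of elements outside Q into Q. *)
  have Ne : N e.
    have [//|ue] := N_or_unit e; have ur : unitform r.
      by exists 1%N, 1, 1; rewrite expr1.
    by case: (unit_notN _ (unitM _ _ ue ur)); rewrite -sp; exact: (idealM _ idN Np).
  have [t Qt [f te]] := pdvd e Ne; apply: (primeM pQ Qt Qs).
  suff -> : t * s = f * r by exact: idealM.
  by apply: (mulIf p0); rewrite -mulrA sp mulrA te; ring.
have dvd0 a : local_dvd Q a 0 by exists 1 => //; exists 0; rewrite mulr0 mul0r.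
have [/N0 ->|[m [s [d [Qs Qd sx]]]]] := N_or_unit x; first by right.
have [/N0 ->|[n [t [c [Qt Qc ty]]]]] := N_or_unit y; first by left.
(* Up to units of D_Q, [x] is r^m and [y] is r^n, so the smaller exponent divides; the witnesses
   come from cross-multiplication. *)
have [mn|/ltnW nm] := leqP m n; [left|right].
  exists (d * t); first exact: primeM.
  exists (c * r ^+ (n - m) * s).
  rewrite -mulrA ty -[in LHS](subnK mn) exprD -mulrA sx; ring.
exists (c * s); first exact: primeM.
exists (d * r ^+ (m - n) * t).
rewrite -mulrA sx -[in LHS](subnK nm) exprD -mulrA ty; ring.
Qed.

(** Finitely generated ideals of the valuation ring D_Q are principal, generated by one of the given
    generators. *)
Lemma local_dvd_min Q s : M Q -> s != [::] ->
  exists2 x, x \in s & forall y, y \in s -> local_dvd Q x y.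
Proof.
move=> MQ; have pQ := quasi_maximal_prime MQ.
elim: s => // a s IH _.
have refl x : local_dvd Q x x by exists 1; [exact: prime_not1|exists 1].
have [->|/IH [x xs xmin]] := eqVneq s [::].
  by exists a; rewrite ?mem_head // => y; rewrite inE => /eqP ->.
have [[w Qw [e we]]|xa] := local_dvd_total a x MQ; last first.
  by exists x; rewrite ?inE ?xs ?orbT // => y /[!inE] /orP[/eqP->|/xmin].
exists a; first exact: mem_head.
move=> y; rewrite inE => /orP[/eqP->//|/xmin [v Qv [f vy]]].
exists (w * v); first exact: primeM.
by exists (f * e); rewrite -mulrA vy mulrCA we mulrA.
Qed.

Lemma invertible_PstarMD : PstarMD star.
Proof.
move=> I nzI /fg_gen /(_ (@subset_refl _ _)) [s [sI nzs /inK_inj eI]].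
apply/star_invertible_local => // Q MQ; have pQ := quasi_maximal_prime MQ.
have [a as0 a0] := proj2 (gen_nonzero s) nzs.
have [|x xs xmin] := @local_dvd_min Q s MQ; first by case: (s) as0.
have x0 : x%:K != 0.
  rewrite tofrac_eq0; apply/eqP => x0; have [w Qw [e]] := xmin a as0.
  rewrite x0 mulr0 => /eqP; rewrite mulf_eq0 (negPf a0) orbF => /eqP w0.
  by apply: Qw; rewrite w0; case: pQ => -[].
(* Locally [x] generates [I]. With [w] clearing the denominators of all y / x, the element w / x
   lies in (D : I), and its product with [x] is [w], outside Q. *)
have [|w Qw wD] := @common_denominator _ Q (DinK D) _ s
    (fun y => y%:K / x%:K) pQ (DinK_submod D).
  move=> y /xmin [w Qw [e wy]]; exists w => //; exists e => //.
  by rewrite mulrA -rmorphM wy rmorphM mulfK.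
exists x, (w%:K / x%:K), w; split=> //; [exact: sI| |by rewrite mulrC divfK].
apply/colonP => i; rewrite eI.
apply: (gen_sub (submod_scaled_preimage _ (DinK_submod D))) => y /wD /=.
have -> // : w%:K * (y%:K / x%:K) = w%:K / x%:K * y%:K.
by ring.
Qed.

End StarClosure.

Theorem theorem4p9 (D : idomainType)
    (star : set {fraction D} -> set {fraction D}) (hstar : semistar star) :
  star_dedekind star <->
  (forall P : set D, quasi_prime (star_tilde star) P ->
     quasi_invertible (star_tilde star) (inK P)).
Proof.
split=> [dd P [_ [nzP _]]|inv]; first exact: dedekind_prime_invertible.
split; first exact: invertible_star_noetherian.
exact: invertible_PstarMD.
Qed.
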